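(* Let $$A=\begin{bmatrix}0&0&0&1&0&0\\0&0&0&0&b&0\\0&0&0&0&c&e\\0&0&0&0&d&f\\0&0&0&0&0&g\\0&0&0&0&0&h\end{bmatrix},$$ where $b,c,d,e,h\ge0$, $f,g\in\mathbb R$, $f\ge0$ if $ce=0$ and $f\le0$ otherwise, $b^2+c^2+d^2=1$, $e^2+f^2+g^2+h^2=1$, $ce+df=0$, and $c=0$ whenever $e=0$. Then the Kippenhahn curve $C(A)$ contains $\mathcal C_{1/2}$ if and only if either (i) $c=d=0$ or (ii) $g=h=0$.
   Context: Put $\operatorname{Re}X=(X+X^* )/2$. The Kippenhahn polynomial of $A\in\mathbb C^{n\times n}$ is $P_A(\lambda,\theta)=\det(\operatorname{Re}(e^{i\theta}A)-\lambda I)$. With $\lambda_1(\theta),\dots,\lambda_n(\theta)$ its roots in $\lambda$, the Kippenhahn curve $C(A)$ is the envelope of the family of lines $\{e^{-i\theta}(\lambda_j(\theta)+i\mathbb R):\theta\in(-\pi,\pi],\ j=1,\dots,n\}$. $\mathcal C_r$ is the circle of radius $r>0$ centered at $0$. The containment $C(A)\supset\mathcal C_r$ holds if and only if, for all $\theta$, $P_A(\lambda,\theta)$ is divisible by $\lambda^2-r^2$ as a polynomial in $\lambda$ (this may be taken as its definition). *)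

(* Defs.v *)
From HB Require Import structures.
From mathcomp Require Import all_boot all_order all_algebra.
From mathcomp Require Import complex.
From mathcomp Require Import reals trigo.

Set Implicit Arguments.
Unset Strict Implicit.
Unset Printing Implicit Defensive.

Import Order.TTheory GRing.Theory Num.Theory.

Local Open Scope ring_scope.
Local Open Scope sesquilinear_scope.
Local Open Scope complex_scope.

Definition expi (R : realType) (theta : R) : R[i] := cos theta +i* sin theta.

Definition re_mx (R : realType) (n : nat) (X : 'M[R[i]]_n) : 'M[R[i]]_n :=
  2^-1 *: (X + X ^t* ).

(* The indeterminate 'X is lambda. *)
Definition kippenhahn_poly (R : realType) (n : nat) (A : 'M[R[i]]_n)
    (theta : R) : {poly R[i]} :=
  \det (map_mx polyC (re_mx (expi theta *: A)) - 'X%:M).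

(* The Kippenhahn curve of A (the envelope of the lines
   e^(-i theta) (lambda_j(theta) + i R)) contains the circle of radius r > 0
   centered at 0: each P_A(., theta) is divisible by 'X^2 - r^2. *)
Definition kippenhahn_contains_circle (R : realType) (n : nat)
    (A : 'M[R[i]]_n) (r : R) : Prop :=
  forall theta : R, ('X^2 - ((r ^+ 2)%:C)%:P) %| kippenhahn_poly A theta.

Definition matrixA (R : realType) (b c d e f g h : R) : 'M[R[i]]_6 :=
  \matrix_(i < 6, j < 6)
    (nth 0 (nth [::]
       [:: [:: 0; 0; 0; 1; 0; 0];
           [:: 0; 0; 0; 0; b; 0];
           [:: 0; 0; 0; 0; c; e];
           [:: 0; 0; 0; 0; d; f];
           [:: 0; 0; 0; 0; 0; g];
           [:: 0; 0; 0; 0; 0; h]] i) j)%:C.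

(* Main.v *)
Require Import Defs.
From mathcomp Require Import all_boot all_order all_algebra.
From mathcomp Require Import complex ring.
From mathcomp Require Import reals trigo.

(** Write A for the matrix [matrixA b c d e f g h].  Since 'X^2 - 1/4 has the
distinct roots 1/2 and -1/2, the curve of A contains the circle of radius 1/2
exactly when 2 Re(e^(i theta) A) has the eigenvalues 1 and -1 for every theta,
that is, when det (w A + conj(w) A^T + t I) vanishes for all w = e^(i theta)
and t = 1, -1.

This determinant is explicit ([det_pencil]): A + A^T is the adjacency matrix of
a weighted graph with edges 1-4, 2-5, 3-5, 3-6, 4-5, 4-6, 5-6 and a loop at 6,
whose only cycles are the triangles 3-5-6 and 4-5-6, the square 3-5-4-6 and the
loop.  Under the unit length of the last two columns and their orthogonality
it collapses, for t^2 = 1 and w conj(w) = 1, to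
  t d (f g - h d) (w + conj(w)) - d^2 (g^2 + h^2)
([det_pencil_sign]).  Here w + conj(w) = 2 cos theta, so taking
theta = pi/2 gives d^2 (g^2 + h^2) = 0: either g = h = 0, or d = 0.  In the
latter case c e = 0 and hence c = 0.  Conversely the expression vanishes
identically when d = 0 or g = h = 0. *)

Set Implicit Arguments.
Unset Strict Implicit.
Unset Printing Implicit Defensive.

Import Order.TTheory GRing.Theory Num.Theory.

Local Open Scope ring_scope.
Local Open Scope complex_scope.

(** The determinant of the n x n matrix with entries [F i j], computed by
Laplace expansion along the first column; an entry [None] stands for 0 and is
skipped, so that a sparse matrix of numeral size evaluates to a short explicit
expression.  The entries are indexed by naturals to let this recursion
compute. *)
Fixpoint sparse_det (K : comNzRingType) (n : nat)
    (F : nat -> nat -> option K) : K :=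
  if n is n'.+1 then
    foldr (fun k s =>
      if F k 0%N is Some a then
        (-1) ^+ k * a * sparse_det n' (fun i j => F (bump k i) j.+1) + s
      else s)
      0 (iota 0 n)
  else 1.

Lemma sparse_detE (K : comNzRingType) (n : nat) (F : nat -> nat -> option K) :
  \det (\matrix_(i < n, j < n) odflt 0 (F i j)) = sparse_det n F.
Proof.
elim: n F => [|n IHn] F; first exact: det_mx00.
rewrite (expand_det_col _ ord0).
transitivity (\sum_(0 <= k < n.+1)
    (-1) ^+ k * odflt 0 (F k 0%N)
    * sparse_det n (fun i j => F (bump k i) j.+1)).
  rewrite big_mkord; apply: eq_bigr => k _.
  rewrite /cofactor mxE addn0 -IHn mulrCA mulrA; congr (_ * \det _).
  by apply/matrixP => i j; rewrite !mxE.
rewrite unlock /index_iota subn0 [RHS]/sparse_det -/(@sparse_det K).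
elim: (iota 0 n.+1) => //= k r ->.
by case: (F k 0%N) => //=; rewrite mulr0 mul0r add0r.
Qed.

(** The matrix [matrixA] over an arbitrary commutative ring. *)
Definition gen_matrixA (K : comNzRingType) (b c d e f g h : K) : 'M[K]_6 :=
  \matrix_(i < 6, j < 6)
    (nth 0 (nth [::]
       [:: [:: 0; 0; 0; 1; 0; 0];
           [:: 0; 0; 0; 0; b; 0];
           [:: 0; 0; 0; 0; c; e];
           [:: 0; 0; 0; 0; d; f];
           [:: 0; 0; 0; 0; 0; g];
           [:: 0; 0; 0; 0; 0; h]] i) j).

(** In u A + v A^T the two directions of each edge of the graph carry the weights
u and v, and s is the diagonal entry at the vertex with the loop.  The first
four terms are the signed weighted sums over the matchings with 0, 1, 2 and 3
edges, the square 3-5-4-6 being absorbed in (c f - d e)^2; the last term comes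
from the two triangles. *)
Lemma det_pencil (K : comNzRingType) (b c d e f g h u v t : K) :
  let A := gen_matrixA b c d e f g h in
  let p := u * v in let x := u + v in let s := t + h * x in
  \det (u *: A + v *: A^T + t%:M) =
    t ^+ 5 * s
    - p * t ^+ 3 * ((1 + b ^+ 2 + c ^+ 2 + d ^+ 2) * s
                    + (e ^+ 2 + f ^+ 2 + g ^+ 2) * t)
    + p ^+ 2 * t * ((b ^+ 2 + c ^+ 2) * s
                    + t * (e ^+ 2 + g ^+ 2 + (b * e) ^+ 2 + (b * f) ^+ 2
                           + (c * f - d * e) ^+ 2))
    - p ^+ 3 * (b * e) ^+ 2
    + g * p * x * t * (c * e * (t ^+ 2 - p) + d * f * t ^+ 2).
Proof.
move=> A p x s.
(* The entries of the pencil, its zeros being marked by None. *)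
pose F i j := nth None (nth [::]
  [:: [:: Some t; None; None; Some u; None; None];
      [:: None; Some t; None; None; Some (u * b); None];
      [:: None; None; Some t; None; Some (u * c); Some (u * e)];
      [:: Some v; None; None; Some t; Some (u * d); Some (u * f)];
      [:: None; Some (v * b); Some (v * c); Some (v * d); Some t;
          Some (u * g)];
      [:: None; None; Some (v * e); Some (v * f); Some (v * g); Some s]] i) j.
transitivity (sparse_det 6 F).
  rewrite -sparse_detE; congr (\det _); apply/matrixP => i j; rewrite !mxE.
  case: i => [[|[|[|[|[|[|i]]]]]] // lti];
    case: j => [[|[|[|[|[|[|j]]]]]] // ltj];
    rewrite /F /s /x /=; ring.
rewrite {A}/F /p /x /s.
(* Only the recursion is unfolded; the ring operations stay folded for ring. *)
lazy beta iota zeta delta [sparse_det foldr iota nth bump nat_of_bool leq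
  addn subn Nat.add Nat.sub eq_op Equality.eqtype_hasDecEq_mixin Equality.class
  hasDecEq.eq_op eqn ssrnat.Datatypes_nat__canonical__eqtype_Equality
  eqtype.Equality.sort ssrnat.HB_unnamed_factory_1].
ring.
Qed.

(** When u v = t^2 = 1, the triangle 3-5-6 no longer contributes to
[det_pencil], and the relations between the last two columns make the part free
of u + v minus a sum of squares. *)
Lemma det_pencil_sign (K : comNzRingType) (b c d e f g h u v t : K) :
  b ^+ 2 + c ^+ 2 + d ^+ 2 = 1 ->
  e ^+ 2 + f ^+ 2 + g ^+ 2 + h ^+ 2 = 1 ->
  c * e + d * f = 0 ->
  u * v = 1 -> t ^+ 2 = 1 ->
  let A := gen_matrixA b c d e f g h in
  \det (u *: A + v *: A^T + t%:M) =
    t * d * (f * g - h * d) * (u + v) - d ^+ 2 * (g ^+ 2 + h ^+ 2).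
Proof.
move=> hcol5 hcol6 horth uv1 tt1 A; rewrite det_pencil uv1.
have -> : t ^+ 5 = t by rewrite (exprD t 2 3) (exprD t 2 1) tt1 !mul1r.
have -> : t ^+ 3 = t by rewrite (exprD t 2 1) tt1 mul1r.
have b2 : b ^+ 2 = 1 - c ^+ 2 - d ^+ 2 by rewrite -hcol5; ring.
have h2 : h ^+ 2 = 1 - e ^+ 2 - f ^+ 2 - g ^+ 2 by rewrite -hcol6; ring.
rewrite tt1 !exprMn b2 h2; apply/eqP; rewrite -subr_eq0; apply/eqP.
(* With b^2 and h^2 eliminated, the difference of both sides is a combination of
the two remaining relations, t^2 = 1 and c e + d f = 0. *)
transitivity ((t ^+ 2 - 1) * ((1 - c ^+ 2 - d ^+ 2) * (e ^+ 2 + f ^+ 2)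
    + (c * f - d * e) ^+ 2 - d ^+ 2 - f ^+ 2) - 2 * d * f * (c * e + d * f)).
  by ring.
by rewrite tt1 horth; ring.
Qed.

Lemma matrixAE (R : realType) (b c d e f g h : R) :
  matrixA b c d e f g h = gen_matrixA b%:C c%:C d%:C e%:C f%:C g%:C h%:C.
Proof.
apply/matrixP => i j; rewrite !mxE.
by case: i => [[|[|[|[|[|[|i]]]]]] // lti];
   case: j => [[|[|[|[|[|[|j]]]]]] // ltj].
Qed.

Lemma expi_mul_conj (R : realType) (theta : R) :
  expi theta * (expi theta)^* = 1.
Proof.
apply/eqP; rewrite eq_complex /=; apply/andP; split; apply/eqP.
  by rewrite mulrN opprK -!expr2 cos2Dsin2.
by ring.
Qed.

Lemma expi_add_conj (R : realType) (theta : R) :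
  expi theta + (expi theta)^* = (2 * cos theta)%:C.
Proof.
by apply/eqP; rewrite eq_complex /=; apply/andP; split; apply/eqP; ring.
Qed.

Lemma root_kippenhahn_poly (R : realType) (n : nat) (A : 'M[R[i]]_n)
    (theta : R) (z : R[i]) :
  root (kippenhahn_poly A theta) z =
  (\det (re_mx (expi theta *: A) - z%:M) == 0).
Proof.
rewrite rootE -horner_evalE /kippenhahn_poly -det_map_mx; congr (\det _ == 0).
apply/matrixP => i j.
by rewrite !mxE /= horner_evalE hornerD hornerN hornerMn hornerX hornerC.
Qed.

(** The Kippenhahn polynomial at [- (t / 2)] is 2^-6 times the determinant of
[det_pencil] with u = e^(i theta) and v its conjugate. *)
Lemma root_kippenhahn_matrixA (R : realType) (b c d e f g h theta t : R) :
  b ^+ 2 + c ^+ 2 + d ^+ 2 = 1 ->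
  e ^+ 2 + f ^+ 2 + g ^+ 2 + h ^+ 2 = 1 ->
  c * e + d * f = 0 ->
  t ^+ 2 = 1 ->
  root (kippenhahn_poly (matrixA b c d e f g h) theta) (- (t / 2))%:C =
  (t * d * (f * g - h * d) * (2 * cos theta)
   - d ^+ 2 * (g ^+ 2 + h ^+ 2) == 0).
Proof.
move=> hcol5 hcol6 horth tt1; rewrite root_kippenhahn_poly.
set A := matrixA _ _ _ _ _ _ _.
have -> : re_mx (expi theta *: A) - (- (t / 2))%:C%:M =
    2^-1 *: (expi theta *: A + (expi theta)^* *: A^T + t%:C%:M).
  rewrite /re_mx [in RHS]scalerDr; congr (_ *: (_ + _) + _).
    apply/matrixP => i j; rewrite !mxE rmorphM; congr (_ * _).
    exact: conjc_real.
  rewrite scale_scalar_mx -raddfN; congr (_%:M).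
  by rewrite rmorphN opprK rmorphM fmorphV rmorph_nat mulrC.
rewrite detZ mulf_eq0 expf_eq0 invr_eq0 pnatr_eq0 /= /A matrixAE.
rewrite det_pencil_sign ?expi_add_conj //.
- rewrite -[RHS](fmorph_eq0 (real_complex R)).
  by rewrite !(rmorphB, rmorphD, rmorphM, rmorphXn).
- by rewrite -(rmorph1 (real_complex R)) -hcol5 !(rmorphD, rmorphXn).
- by rewrite -(rmorph1 (real_complex R)) -hcol6 !(rmorphD, rmorphXn).
- by rewrite -(rmorph0 (real_complex R)) -horth !(rmorphD, rmorphM).
- exact: expi_mul_conj.
- by rewrite -(rmorph1 (real_complex R)) -tt1 rmorphXn.
Qed.

(** Since 'X^2 - 1/4 splits into coprime linear factors, divisibility by it
means having the roots 1/2 and -1/2. *)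
Lemma kippenhahn_contains_half_circle_root (R : realType) (n : nat)
    (A : 'M[R[i]]_n) :
  kippenhahn_contains_circle A 2^-1 <->
  (forall theta t : R, t ^+ 2 = 1 ->
     root (kippenhahn_poly A theta) (- (t / 2))%:C).
Proof.
have fact : 'X^2 - ((2^-1 ^+ 2)%:C)%:P =
    ('X - ((- (1 / 2 : R))%:C)%:P) * ('X - ((- (-1 / 2 : R))%:C)%:P).
  have -> : - (-1 / 2) = 1 / 2 :> R by rewrite mulNr opprK.
  by rewrite div1r !rmorphN !rmorphXn; ring.
have cop : coprimep ('X - ((- (1 / 2 : R))%:C)%:P)
                    ('X - ((- (-1 / 2 : R))%:C)%:P).
  apply: coprimep_XsubC2; rewrite -rmorphB fmorph_eq0.
  have -> : - (-1 / 2) - - (1 / 2) = 1 :> R by field.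
  exact: oner_neq0.
split=> [C theta t /eqP|C theta].
  have := C theta; rewrite fact Gauss_dvdp // !dvdp_XsubCl => /andP[r1 rN1].
  by rewrite sqrf_eq1 => /orP[] /eqP ->.
rewrite fact Gauss_dvdp // !dvdp_XsubCl.
by apply/andP; split; apply: C; rewrite ?sqrrN expr1n.
Qed.

Theorem theorem7p1 (R : realType) (b c d e f g h : R)
  (hb : 0 <= b) (hc : 0 <= c) (hd : 0 <= d) (he : 0 <= e) (hh : 0 <= h)
  (hf_nneg : c * e = 0 -> 0 <= f)
  (hf_npos : c * e <> 0 -> f <= 0)
  (hcol5 : b ^+ 2 + c ^+ 2 + d ^+ 2 = 1)
  (hcol6 : e ^+ 2 + f ^+ 2 + g ^+ 2 + h ^+ 2 = 1)
  (horth : c * e + d * f = 0)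
  (hce : e = 0 -> c = 0) :
  kippenhahn_contains_circle (matrixA b c d e f g h) 2^-1 <->
  (c = 0 /\ d = 0) \/ (g = 0 /\ h = 0).
Proof.
rewrite kippenhahn_contains_half_circle_root; split=> [C|].
  (* At theta = pi/2 the term in cos theta disappears. *)
  have := C (pi / 2) 1 (expr1n _ _).
  rewrite root_kippenhahn_matrixA ?expr1n // cos_pihalf !mulr0 sub0r oppr_eq0 mulf_eq0 sqrf_eq0.
  case/orP => [/eqP d0|].
    left; split=> //; move/eqP: horth.
    by rewrite d0 mul0r addr0 mulf_eq0 => /orP[/eqP|/eqP/hce].
  rewrite paddr_eq0 ?sqr_ge0 // !sqrf_eq0 => /andP[/eqP g0 /eqP h0].
  by right.
move=> deg theta t tt1; rewrite root_kippenhahn_matrixA //; apply/eqP.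
by case: deg => [[_ d0]|[g0 h0]]; rewrite ?d0 ?g0 ?h0; ring.
Qed.
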